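(* Let $A$ be a finite nilpotent algebra over a finite field $\mathbf F$, let $m=\dim_{\mathbf F} A$ and let $c$ be the nilpotency class of $A$. Then for every $n\ge m(c+1)$ the free algebra $F_n$ of rank $n$ in the variety $\operatorname{var}A$ is residually $A$; that is, for every nonzero $b\in F_n$ there is a surjective homomorphism $\varphi:F_n\to A$ with $\varphi(b)\ne 0$.
   Context: An algebra over a field $\mathbf F$ is a vector space over $\mathbf F$ with a bilinear multiplication (not assumed associative, commutative or unital). $\operatorname{var}A$ is the class of all $\mathbf F$-algebras satisfying every identity $v(x_1,\dots,x_n)=0$ that holds in $A$, where $v$ ranges over nonassociative polynomials over $\mathbf F$ without constant term. The free algebra $F_n$ of rank $n$ in a variety $\mathfrak V$ is the algebra in $\mathfrak V$ generated by elements $x_1,\dots,x_n$ such that every map $\{x_1,\dots,x_n\}\to P\in\mathfrak V$ extends to a homomorphism $F_n\to P$. For an algebra $A$, put $A^1=A$ and $A^k=\sum_{s+t=k}A^sA^t$, where $LM$ denotes the linear span of all products $lm$, $l\in L$, $m\in M$. $A$ is nilpotent if $A^{c+1}=\{0\}$ for some $c\ge1$; the least such $c$ is its nilpotency class. *)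

(* Defs.v *)
From HB Require Import structures.
From mathcomp Require Import all_boot all_order all_algebra.
From mathcomp Require Import sesquilinear.

Set Implicit Arguments.
Unset Strict Implicit.
Unset Printing Implicit Defensive.

Import GRing.Theory.
Local Open Scope ring_scope.

(* An algebra over F is given by a vector space V : lmodType F and a          *)
(* multiplication mul : {bilinear V -> V -> V}; neither associativity,        *)
(* commutativity nor a unit is assumed.                                       *)

(* Nonassociative monomials of degree at least 1 in n variables, so that a    *)
(* linear combination of them has no constant term.                           *)
Inductive monomial (n : nat) : Type :=
  | MVar of 'I_n
  | MMul of monomial n & monomial n.

(* The list of pairs (coefficient, monomial) stands for the polynomial that   *)
(* is the sum of its terms. Distinct lists may represent the same polynomial; *)
(* the value of a polynomial depends only on the sum.                         *)
Definition napoly (F : fieldType) (n : nat) : Type := seq (F * monomial n).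

Section Algebra.
Variables (F : fieldType) (V : lmodType F) (mul : {bilinear V -> V -> V}).

Fixpoint eval_monomial n (a : 'I_n -> V) (w : monomial n) : V :=
  match w with
  | MVar i => a i
  | MMul u v => mul (eval_monomial a u) (eval_monomial a v)
  end.

Definition eval_napoly n (a : 'I_n -> V) (v : napoly F n) : V :=
  \sum_(t <- v) t.1 *: eval_monomial a t.2.

Definition satisfies n (v : napoly F n) : Prop :=
  forall a : 'I_n -> V, eval_napoly a v = 0.

(* power k a means a \in V^k. For k >= 2 the last three constructors make V^k *)
(* the linear span of the products of V^s and V^t with s + t = k. The index 0 *)
(* is junk: power 0 only holds of 0, hence powerM contributes nothing to      *)
(* V^(s + t) when s or t is 0.                                                *)
Inductive power : nat -> V -> Prop :=
  | power1 a : power 1 a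
  | powerM s t a b : power s a -> power t b -> power (s + t) (mul a b)
  | power_zero k : power k 0
  | powerD k a b : power k a -> power k b -> power k (a + b)
  | powerZ k (z : F) a : power k a -> power k (z *: a).

Definition power_vanishes (k : nat) : Prop := forall a, power k a -> a = 0.

Definition nilpotent : Prop :=
  exists c : nat, (1 <= c)%N /\ power_vanishes c.+1.

Definition nilpotency_class (c : nat) : Prop :=
  [/\ (1 <= c)%N, power_vanishes c.+1 &
      forall d : nat, (1 <= d)%N -> power_vanishes d.+1 -> (c <= d)%N].

Definition subalgebra (S : V -> Prop) : Prop :=
  [/\ S 0,
      forall a b, S a -> S b -> S (a + b),
      forall (z : F) a, S a -> S (z *: a) &
      forall a b, S a -> S b -> S (mul a b)].

Definition generated_by n (x : 'I_n -> V) : Prop :=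
  forall S : V -> Prop, subalgebra S -> (forall i, S (x i)) -> forall a, S a.

End Algebra.

Definition algebra_hom (F : fieldType) (V W : lmodType F)
    (mulV : {bilinear V -> V -> V}) (mulW : {bilinear W -> W -> W})
    (phi : {linear V -> W}) : Prop :=
  forall a b, phi (mulV a b) = mulW (phi a) (phi b).

Definition in_var (F : fieldType)
    (A : lmodType F) (mulA : {bilinear A -> A -> A})
    (P : lmodType F) (mulP : {bilinear P -> P -> P}) : Prop :=
  forall n (v : napoly F n), satisfies mulA v -> satisfies mulP v.

(* (Fn, mulF) is the free algebra of rank n in var A on x_0, ..., x_(n-1). *)
Definition free_in_var (F : fieldType)
    (A : lmodType F) (mulA : {bilinear A -> A -> A})
    (n : nat) (Fn : lmodType F) (mulF : {bilinear Fn -> Fn -> Fn})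
    (x : 'I_n -> Fn) : Prop :=
  [/\ in_var mulA mulF,
      generated_by mulF x &
      forall (P : lmodType F) (mulP : {bilinear P -> P -> P}),
        in_var mulA mulP ->
        forall f : 'I_n -> P, exists phi : {linear Fn -> P},
          algebra_hom mulF mulP phi /\ (forall i, phi (x i) = f i)].

Definition residually (F : fieldType)
    (V : lmodType F) (mulV : {bilinear V -> V -> V})
    (A : lmodType F) (mulA : {bilinear A -> A -> A}) : Prop :=
  forall b : V, b <> 0 -> exists phi : {linear V -> A},
    [/\ algebra_hom mulV mulA phi, (forall y : A, exists a : V, phi a = y) &
        phi b <> 0].

(* Main.v *)
(* Write b = v(x) with v a polynomial; v is not an identity of A, so v(a) <> 0
   for some n-tuple a in A. Split the n indices into c+1 blocks, each long
   enough to carry a basis of A, and for a set S of blocks let a_S be the tuple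
   obtained from a by writing a basis of A on every block of S. Each monomial
   that does not vanish on A has degree at most c, so it misses a block k, and
   the terms of S and of S with k added cancel in the alternating sum
   sum_S (-1)^|S| v(a_S). This sum is thus 0, while its term v(a) for S empty is
   not; hence v(a_S) <> 0 for some nonempty S, and a_S spans A. *)
Require Import Defs.
From HB Require Import structures.
From mathcomp Require Import all_boot all_order all_algebra.
From mathcomp Require Import sesquilinear finfield.

Set Implicit Arguments.
Unset Strict Implicit.
Unset Printing Implicit Defensive.

Import GRing.Theory.
Local Open Scope ring_scope.

(** Variables are listed with repetition, so the size of the list is the degree. *)
Fixpoint leaves (n : nat) (w : monomial n) : seq 'I_n :=
  match w with
  | MVar i => [:: i]
  | MMul u v => leaves u ++ leaves v
  end.

Lemma leaves_gt0 (n : nat) (w : monomial n) : (0 < size (leaves w))%N.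
Proof. by elim: w => //= u IHu v _; rewrite size_cat ltn_addr. Qed.

Section Evaluation.
Variables (F : fieldType) (V : lmodType F) (mul : {bilinear V -> V -> V}).

Lemma eval_monomial_power (n : nat) (a : 'I_n -> V) (w : monomial n) (k : nat) :
  (0 < k <= size (leaves w))%N -> power mul k (eval_monomial mul a w).
Proof.
elim: w k => [i|u IHu v IHv] k /=.
  by rewrite -eqn_leq => /eqP <-; apply: power1.
rewrite size_cat => /andP[k_gt0 le_k].
case: k k_gt0 le_k => [|[|k]] // _ le_k; first exact: power1.
have u_gt0 := leaves_gt0 u; have v_gt0 := leaves_gt0 v.
(* The left factor takes as much of the exponent [k.+2] as its degree allows, but at most [k.+1], so
   that a positive exponent remains for the right factor. *)
have le_s : (minn (size (leaves u)) k.+1 <= k.+2)%N.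
  by rewrite (leq_trans (geq_minr _ _)).
rewrite -[k.+2](subnKC le_s); apply: powerM.
  by apply: IHu; rewrite leq_min u_gt0 geq_minl.
apply: IHv; rewrite subn_gt0 ltnS geq_minr /= leq_subLR.
by case: (leqP (size (leaves u)) k.+1) => // _; rewrite -[k.+2]addn1 leq_add2l.
Qed.

Lemma eq_in_eval_monomial (n : nat) (a b : 'I_n -> V) (w : monomial n) :
  {in leaves w, a =1 b} -> eval_monomial mul a w = eval_monomial mul b w.
Proof.
elim: w => [i|u IHu v IHv] /= eq_ab; first by apply: eq_ab; rewrite mem_head.
by rewrite IHu ?IHv // => i iw; apply: eq_ab; rewrite mem_cat iw ?orbT.
Qed.

Lemma eq_eval_napoly (n : nat) (a b : 'I_n -> V) (v : napoly F n) :
  a =1 b -> eval_napoly mul a v = eval_napoly mul b v.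
Proof.
by move=> eq_ab; apply: eq_bigr => t _; congr (_ *: _); apply: eq_in_eval_monomial.
Qed.

(** The values of polynomials at [x] form a subalgebra that contains every [x i]. *)
Lemma generated_by_eval (n : nat) (x : 'I_n -> V) (b : V) :
  generated_by mul x -> exists v : napoly F n, b = eval_napoly mul x v.
Proof.
move=> x_gen.
apply: (x_gen (fun b => exists v : napoly F n, b = eval_napoly mul x v)); last first.
  by move=> i; exists [:: (1, MVar i)]; rewrite /eval_napoly big_seq1 scale1r.
rewrite /eval_napoly; split.
- by exists [::]; rewrite big_nil.
- by move=> _ _ [p ->] [q ->]; exists (p ++ q); rewrite big_cat.
- move=> z _ [p ->]; exists [seq (z * t.1, t.2) | t <- p].
  by rewrite big_map scaler_sumr; apply: eq_bigr => t _; rewrite scalerA.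
- move=> _ _ [p ->] [q ->].
  exists [seq (t.1 * s.1, MMul t.2 s.2) | t <- p, s <- q].
  rewrite big_allpairs_dep linear_sumlz; apply: eq_bigr => t _.
  rewrite linear_sumr; apply: eq_bigr => s _ /=.
  by rewrite linearZl_LR linearZr_LR /= scalerA.
Qed.

Definition overwrite (n : nat) (T : finType) (beta : 'I_n -> T) (a e : 'I_n -> V)
  (S : {set T}) (i : 'I_n) : V := if beta i \in S then e i else a i.

Lemma alternating_eval_monomial_eq0 (n : nat) (T : finType) (beta : 'I_n -> T)
    (a e : 'I_n -> V) (w : monomial n) :
  (size (leaves w) < #|T|)%N ->
  \sum_(S : {set T})
     (-1) ^+ #|S| *: eval_monomial mul (overwrite beta a e S) w = 0.
Proof.
move=> lt_wT.
(* Pigeonhole: [w] has fewer leaves than there are blocks. *)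
have [k kNw] : exists k, k \notin map beta (leaves w).
  apply/existsP; rewrite -negb_forall; apply/negP => /forallP all_w.
  move: lt_wT; rewrite ltnNge -(size_map beta) => /negP; apply.
  by apply: leq_trans (card_size _); apply: subset_leq_card; apply/subsetP.
rewrite (bigID (fun S : {set T} => k \in S)) /=.
(* Both halves of the sum are now indexed by the sets that avoid [k], ready for termwise
   cancellation. *)
rewrite (reindex_onto (fun S => k |: S) (fun S => S :\ k)) /=; last first.
  by move=> S kS; rewrite setD1K.
rewrite (eq_bigl (fun S : {set T} => k \notin S)); last first.
  move=> S /=; rewrite setU11 /=; apply/eqP/idP => [<-|kS]; last exact: setU1K.
  by rewrite setD11.
rewrite -big_split big1 //= => S kS.
rewrite cardsU1 kS exprS mulN1r scaleNr.
suff -> : eval_monomial mul (overwrite beta a e (k |: S)) w =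
          eval_monomial mul (overwrite beta a e S) w by rewrite addNr.
apply: eq_in_eval_monomial => i iw; rewrite /overwrite in_setU1.
by case: eqP => // ki; case/negP: kNw; rewrite -ki map_f.
Qed.

Lemma alternating_eval_napoly_eq0 (c n : nat) (T : finType) (beta : 'I_n -> T)
    (a e : 'I_n -> V) (v : napoly F n) :
  power_vanishes mul c.+1 -> (c < #|T|)%N ->
  \sum_(S : {set T})
     (-1) ^+ #|S| *: eval_napoly mul (overwrite beta a e S) v = 0.
Proof.
move=> nil_c lt_cT; rewrite /eval_napoly.
under eq_bigr => S _ do rewrite scaler_sumr.
rewrite exchange_big big1 //= => -[z w] _ /=.
under eq_bigr => S _ do rewrite scalerA mulrC -scalerA.
(* Monomials of degree above [c] vanish by nilpotency; the others miss a block. *)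
rewrite -scaler_sumr; have [lt_cw|le_wc] := ltnP c (size (leaves w)).
  rewrite big1 ?scaler0 // => S _.
  by rewrite [eval_monomial _ _ _]nil_c ?scaler0 //; apply: eval_monomial_power.
by rewrite alternating_eval_monomial_eq0 ?scaler0 ?(leq_ltn_trans le_wc).
Qed.

Lemma overwrite_eval_neq0 (c n : nat) (T : finType) (beta : 'I_n -> T)
    (a e : 'I_n -> V) (v : napoly F n) :
  power_vanishes mul c.+1 -> (c < #|T|)%N -> eval_napoly mul a v != 0 ->
  exists2 S : {set T}, S != set0 &
    eval_napoly mul (overwrite beta a e S) v != 0.
Proof.
move=> nil_c lt_cT nz_va.
apply/exists_inP; apply: contraNT nz_va; rewrite negb_exists => /forallP vS0.
have := alternating_eval_napoly_eq0 beta a e v nil_c lt_cT.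
rewrite (bigD1 set0) //= cards0 expr0 scale1r big1 => [|S S0]; last first.
  by have := vS0 S; rewrite S0 negbK => /eqP->; rewrite scaler0.
rewrite addr0 => <-; apply/eqP; apply: eq_eval_napoly => i.
by rewrite /overwrite in_set0.
Qed.

End Evaluation.

Lemma hom_eval_napoly (F : fieldType) (V W : lmodType F)
    (mulV : {bilinear V -> V -> V}) (mulW : {bilinear W -> W -> W})
    (phi : {linear V -> W}) (n : nat) (a : 'I_n -> V) (v : napoly F n) :
  algebra_hom mulV mulW phi ->
  phi (eval_napoly mulV a v) = eval_napoly mulW (phi \o a) v.
Proof.
move=> phiM; rewrite linear_sum; apply: eq_bigr => t _ /=; rewrite linearZ /=.
by congr (_ *: _); elim: t.2 => //= u IHu w IHw; rewrite phiM IHu IHw.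
Qed.

Lemma linear_onto_basis (F : fieldType) (V : lmodType F) (A : vectType F)
    (phi : {linear V -> A}) :
  (forall j : 'I_(\dim {:A}), exists a, phi a = (vbasis {:A})`_j) ->
  forall y, exists a, phi a = y.
Proof.
move=> onto_basis y; rewrite [y](coord_vbasis (memvf y)).
elim/big_rec: _ => [|j z _ [a <-]]; first by exists 0; rewrite linear0.
have [aj <-] := onto_basis j.
by exists (coord (vbasis {:A}) j y *: aj + a); rewrite linearD linearZ.
Qed.

(* A vectType over a finFieldType is exactly a finite algebra over F: a      *)
(* vector space over a finite field is finite iff it is finite-dimensional. *)
Theorem theorem5 (F : finFieldType) (A : vectType F)
    (mulA : {bilinear A -> A -> A}) (c : nat)
    (A_nilpotent : nilpotent mulA) (A_class : nilpotency_class mulA c)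
    (n : nat) (n_large : (\dim {:A} * c.+1 <= n)%N)
    (Fn : lmodType F) (mulF : {bilinear Fn -> Fn -> Fn})
    (x : 'I_n -> Fn) (Fn_free : free_in_var mulA mulF x) :
  residually mulF mulA.
Proof.
case: Fn_free => Fn_var Fn_gen Fn_univ b; case: A_class => _ nil_c _.
have [v ->] := generated_by_eval b Fn_gen => nz_b.
have [a nz_va] : exists a : {ffun 'I_n -> A}, eval_napoly mulA a v != 0.
  (* As A is finite, the existence of such a tuple is decidable. *)
  have [/existsP[a nz_va]|] :=
    boolP [exists a : {ffun 'I_n -> finvect_type A}, eval_napoly mulA a v != 0].
    by exists a.
  (* Otherwise [v] is an identity of [A], hence of [Fn], and its value at [x] is zero. *)
  rewrite negb_exists => /forallP v0; case: nz_b; apply: Fn_var => a.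
  have /negPn/eqP <- := v0 [ffun i => a i].
  by apply: eq_eval_napoly => i; rewrite ffunE.
set m : nat := \dim {:A} in n_large *.
(* Indices beyond the c+1 blocks of length m are thrown into block 0. *)
pose beta (i : 'I_n) : 'I_c.+1 := inord (i %/ m).
pose e (i : 'I_n) : A := (vbasis {:A})`_(i %% m).
have lt_c : (c < #|'I_c.+1|)%N by rewrite card_ord.
have [S /set0Pn[k kS] nz_vS] := overwrite_eval_neq0 beta e nil_c lt_c nz_va.
(* [A] lies in its own variety, so the universal property applies to it. *)
have [phi [phiM phi_x]] := Fn_univ A mulA (fun _ _ => id) (overwrite beta a e S).
exists phi; split=> //; last first.
  by rewrite (hom_eval_napoly _ _ phiM) (eq_eval_napoly _ _ phi_x); apply/eqP.
apply: linear_onto_basis => j.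
(* This is position [j] of block [k], where [e] takes the basis vector of index [j]. *)
have lt_i : (k * m + j < n)%N.
  apply: leq_trans n_large; rewrite mulnC -addnS.
  apply: (@leq_trans (m * k + m)); rewrite ?leq_add2l //.
  by rewrite -mulnSr leq_mul2l ltn_ord orbT.
(* The index [j] itself rules out [m = 0], so dividing by [m] is meaningful. *)
have m_gt0 : (0 < m)%N by apply: leq_ltn_trans (ltn_ord j).
exists (x (Ordinal lt_i)); rewrite phi_x /overwrite /beta /e /=.
by rewrite divnMDl // divn_small // addn0 inord_val kS modnMDl modn_small.
Qed.
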